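(* Let $(M,g,J)$ be a $2n$-dimensional Hermitian manifold, $n>1$, with Kähler form $\Omega(X,Y)=g(X,JY)$, Lee form $\theta=\frac{1}{n-1}\,d^{*}\Omega\circ J$ and Levi-Civita connection $\nabla$, and suppose that $d\Omega=\theta\wedge\Omega$ (which is the case when $n=2$, or when $n>2$ and $(M,g,J)$ is locally conformal Kähler). Let $\nabla^C$ and $\nabla^B$ be the Chern and Bismut connections, given by $$g(\nabla^C_XY,Z)=g(\nabla_XY,Z)+\tfrac12 d\Omega(JX,Y,Z),\qquad g(\nabla^B_XY,Z)=g(\nabla_XY,Z)-\tfrac12 d\Omega(JX,JY,JZ),$$ and let $A^C=\nabla^C-\nabla$ and $A^B=\nabla^B-\nabla$. Then: (i) $(M,g,A^C)$ is a weak Frobenius structure if and only if for all $X,Y,Z\in\mathcal{X}(M)$ $$d^{*}\Omega(X)\Omega(Y,Z)+d^{*}\Omega(JY)g(Z,X)-d^{*}\Omega(JZ)g(X,Y)=d^{*}\Omega(Y)\Omega(Z,X)+d^{*}\Omega(JZ)g(X,Y)-d^{*}\Omega(JX)g(Y,Z).$$ (ii) $(M,g,A^B)$ is a weak Frobenius structure if and only if for all $X,Y,Z\in\mathcal{X}(M)$ $$d^{*}\Omega(X)\Omega(Y,Z)+d^{*}\Omega(Y)\Omega(Z,X)+d^{*}\Omega(Z)\Omega(X,Y)=d^{*}\Omega(Y)\Omega(Z,X)+d^{*}\Omega(Z)\Omega(X,Y)+d^{*}\Omega(X)\Omega(Y,Z).$$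
   Context: $\mathcal{X}(M)$ denotes the smooth vector fields on $M$. $J$ is the complex structure and $g$ a compatible (Hermitian) Riemannian metric, $g(JX,JY)=g(X,Y)$. $d^{*}$ is the codifferential of $g$, so $d^{*}\Omega$ is a $1$-form and $\theta(X)=\frac{1}{n-1}d^{*}\Omega(JX)$. The wedge product is normalized by $(\theta\wedge\Omega)(X,Y,Z)=\theta(X)\Omega(Y,Z)+\theta(Y)\Omega(Z,X)+\theta(Z)\Omega(X,Y)$. For a Riemannian metric $g$ on $M$ and a tensor field $A$ of type $(1,2)$, the triple $(M,g,A)$ is called a weak Frobenius structure if $g(A(X,Y),Z)=g(X,A(Y,Z))$ for all $X,Y,Z\in\mathcal{X}(M)$ (no symmetry of $A$ is required). *)

(* Defs.v *)
From HB Require Import structures.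
From mathcomp Require Import all_boot all_order all_algebra.
From mathcomp Require Import all_classical all_reals topology normedtype derive.
From mathcomp Require Import ring.
Set Implicit Arguments. Unset Strict Implicit. Unset Printing Implicit Defensive.
Import Order.TTheory GRing.Theory Num.Theory.
Import numFieldNormedType.Exports.
Local Open Scope classical_set_scope.
Local Open Scope ring_scope.

Section Euclidean.
Variables (R : realType) (m : nat).
Implicit Types (U : set 'rV[R]_m) (f h : 'rV[R]_m -> R).

Fixpoint Ck (k : nat) U f : Prop :=
  (forall x, U x -> {for x, continuous f}) /\
  if k is k'.+1 then
    forall i : 'I_m, (forall x, U x -> derivable f x (delta_mx 0 i)) /\
      Ck k' U (fun x => 'D_(delta_mx 0 i) f x)
  else True.

Definition smooth_on U f := forall k, Ck k U f.

Lemma Ck_cts k U f x : Ck k U f -> U x -> {for x, continuous f}.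
Proof. by case: k => [|k] [+ _]; apply. Qed.

Lemma Ck_ext k U f h : open U -> (forall x, U x -> f x = h x) ->
  Ck k U f -> Ck k U h.
Proof.
move=> oU.
have E f1 h1 : (forall x, U x -> f1 x = h1 x) ->
    forall x, U x -> {near x, f1 =1 h1}.
  by move=> e x Ux; apply: filterS e (open_nbhs_nbhs (conj oU Ux)).
have C f1 h1 : (forall x, U x -> f1 x = h1 x) ->
   (forall x, U x -> {for x, continuous f1}) ->
   (forall x, U x -> {for x, continuous h1}).
  move=> e cf x Ux; rewrite /prop_for /continuous_at -(e x Ux).
  by apply: cvg_trans (cf x Ux); exact: (near_eq_cvg (E _ _ e x Ux)).
elim: k f h => [|k IH] f h e [cf dk]; split; try exact: (C _ _ e cf).
  by [].
move=> i; have [df kf] := dk i; split.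
  by move=> x Ux; apply: near_eq_derivable (df x Ux); exact: (E _ _ e x Ux).
apply: IH kf => x Ux; apply: near_eq_derive; exact: (E _ _ e x Ux).
Qed.

Lemma CkS k U f : Ck k.+1 U f -> Ck k U f.
Proof.
elim: k f => [|k IH] f [cf df]; split => // i.
by have [? ?] := df i; split => //; exact: IH.
Qed.

Lemma Ck_cst k U a : Ck k U (cst a).
Proof.
elim: k a => [|k IH] a; split=> // x; try by move=> _; exact: cst_continuous.
split=> [y _|]; first exact: derivable_cst.
rewrite (_ : (fun y => _) = cst 0) //.
by apply/funext => y; exact: derive_cst.
Qed.

Lemma CkD k U f h : open U -> Ck k U f -> Ck k U h -> Ck k U (f + h).
Proof.
move=> oU; elim: k f h => [|k IH] f h [cf df] [ch dh].
  by split=> // x Ux; apply: continuousD; [exact: cf|exact: ch].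
split=> [x Ux|i]; first by apply: continuousD; [exact: cf|exact: ch].
have [df1 df2] := df i; have [dh1 dh2] := dh i.
split=> [x Ux|]; first by apply: derivableD; [exact: df1|exact: dh1].
apply: Ck_ext (IH _ _ df2 dh2) => // x Ux.
by rewrite deriveD; [|exact: df1|exact: dh1].
Qed.

Lemma CkM k U f h : open U -> Ck k U f -> Ck k U h -> Ck k U (f * h).
Proof.
move=> oU; elim: k f h => [|k IH] f h Cf Ch.
  by split=> // x Ux; apply: continuousM; [exact: Ck_cts Cf Ux|exact: Ck_cts Ch Ux].
split=> [x Ux|i].
  by apply: continuousM; [exact: Ck_cts Cf Ux|exact: Ck_cts Ch Ux].
have [df1 df2] := Cf.2 i; have [dh1 dh2] := Ch.2 i.
split=> [x Ux|]; first by apply: derivableM; [exact: df1|exact: dh1].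
have H := CkD oU (IH _ _ (CkS Cf) dh2) (IH _ _ (CkS Ch) df2).
apply: Ck_ext H => // x Ux.
by rewrite deriveM; [|exact: df1|exact: dh1].
Qed.

End Euclidean.

Record chart (R : realType) (m : nat) (M : topologicalType) := Chart {
  chart_dom : set M;
  chart_cod : set 'rV[R]_m;
  chart_map : M -> 'rV[R]_m;
  chart_inv : 'rV[R]_m -> M;
  chart_dom_open : open chart_dom;
  chart_cod_open : open chart_cod;
  chart_map_cod : forall p, chart_dom p -> chart_cod (chart_map p);
  chart_inv_dom : forall v, chart_cod v -> chart_dom (chart_inv v);
  chart_mapK : forall p, chart_dom p -> chart_inv (chart_map p) = p;
  chart_invK : forall v, chart_cod v -> chart_map (chart_inv v) = v;
  chart_map_cts : forall p, chart_dom p -> {for p, continuous chart_map};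
  chart_inv_cts : forall v, chart_cod v -> {for v, continuous chart_inv} }.

Definition smooth_transition (R : realType) (m : nat) (M : topologicalType)
    (c d : chart R m M) :=
  forall i : 'I_m,
    smooth_on [set v | chart_cod c v /\ chart_dom d (chart_inv c v)]
              (fun v => chart_map d (chart_inv c v) 0 i).

Record smooth_manifold (R : realType) (m : nat) := SmoothManifold {
  carrier :> topologicalType;
  atlas : set (chart R m carrier);
  carrier_hausdorff : hausdorff_space carrier;
  carrier_second_countable : @second_countable carrier;
  atlas_cover : forall p, exists2 c, atlas c & chart_dom c p;
  atlas_compatible : forall c d, atlas c -> atlas d -> smooth_transition c d }.

(* The charts of the maximal atlas. *)
Definition is_smooth_chart (R : realType) (m : nat) (M : smooth_manifold R m)
    (c : chart R m M) :=
  forall d, atlas d -> smooth_transition c d /\ smooth_transition d c.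

Section SmoothFunctions.
Variables (R : realType) (m : nat) (M : smooth_manifold R m).

Definition smooth_fun (f : M -> R) :=
  forall c, @atlas R m M c -> smooth_on (chart_cod c) (f \o chart_inv c).

Definition smooth_pred : {pred M -> R} := [pred f | `[< smooth_fun f >]].

Lemma smooth_predP f : reflect (smooth_fun f) (f \in smooth_pred).
Proof. exact: asboolP. Qed.

Record cinf := Cinf { cinf_fun :> M -> R; _ : cinf_fun \in smooth_pred }.

HB.instance Definition _ := [isSub for cinf_fun].
HB.instance Definition _ := [Choice of cinf by <:].

Lemma smooth_fun_cst (a : R) : smooth_fun (cst a).
Proof. by move=> c _ k; exact: Ck_cst. Qed.

Fact smooth_subring_closed : subring_closed smooth_pred.
Proof.
split=> [|f h|f h].
- by apply/smooth_predP; exact: smooth_fun_cst.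
- move=> /smooth_predP sf /smooth_predP sh; apply/smooth_predP => c ac k.
  rewrite (_ : _ \o _ = (f \o chart_inv c) +
           (cst (-1) * (h \o chart_inv c))); last first.
    apply/funext => v.
    change (f (chart_inv c v) - h (chart_inv c v) =
            f (chart_inv c v) + (-1) * h (chart_inv c v)).
    by rewrite mulN1r.
  apply: CkD; [exact: chart_cod_open|exact: sf|].
  by apply: CkM; [exact: chart_cod_open|exact: Ck_cst|exact: sh].
- move=> /smooth_predP sf /smooth_predP sh; apply/smooth_predP => c ac k.
  rewrite (_ : _ \o _ = (f \o chart_inv c) * (h \o chart_inv c)) //.
  by apply: CkM; [exact: chart_cod_open|exact: sf|exact: sh].
Qed.
HB.instance Definition _ :=
  GRing.SubChoice_isSubComPzRing.Build _ _ cinf smooth_subring_closed.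

Lemma cinf_eqP (f h : cinf) : (forall p, f p = h p) -> f = h.
Proof. by move=> fh; apply/val_inj/funext. Qed.

Fact smooth_cst_subproof (a : R) : cst a \in smooth_pred.
Proof. by apply/smooth_predP; exact: smooth_fun_cst. Qed.
Definition cinf_cst (a : R) : cinf := Cinf (smooth_cst_subproof a).

End SmoothFunctions.

Section VectorFields.
Variables (R : realType) (m : nat) (M : smooth_manifold R m).
Local Notation C := (cinf M).

(* A smooth vector field is identified with the R-linear derivation of the ring
   of smooth functions that it induces. *)
Definition is_derivation (D : C -> C^o) :=
  (forall (a : R) (f h : C),
      D (cinf_cst M a * f + h) = cinf_cst M a * D f + D h) /\
  (forall f h : C, D (f * h) = f * D h + h * D f).

Definition derivation_pred : {pred C -> C^o} := [pred D | `[< is_derivation D >]].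

Lemma derivation_predP D : reflect (is_derivation D) (D \in derivation_pred).
Proof. exact: asboolP. Qed.

Record vf := Vf { vf_fun :> C -> C^o; _ : vf_fun \in derivation_pred }.

HB.instance Definition _ := [isSub for vf_fun].
HB.instance Definition _ := [Choice of vf by <:].

Fact derivation_submod_closed : submod_closed derivation_pred.
Proof.
split.
  by apply/derivation_predP; split=> [a f h|f h]; rewrite /= ?mulr0 ?addr0.
move=> u D E /derivation_predP[DL DM] /derivation_predP[EL EM].
have E1 (a x y z w : C) :
    u * (a * x + y) + (a * z + w) = a * (u * x + z) + (u * y + w) by ring.
have E2 (x y z w a b : C) :
    u * (a * x + b * y) + (a * z + b * w) = a * (u * x + z) + b * (u * y + w).
  by ring.
apply/derivation_predP; split=> [a f h|f h].
- by rewrite -[LHS]/(u * D _ + E _) DL EL; exact: E1.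
- by rewrite -[LHS]/(u * D _ + E _) DM EM; exact: E2.
Qed.
HB.instance Definition _ :=
  GRing.isSubmodClosed.Build C (C -> C^o) derivation_pred derivation_submod_closed.
HB.instance Definition _ := [SubChoice_isSubLmodule of vf by <:].

Lemma vfP (X : vf) : is_derivation X.
Proof. by case: X => D /=; move/derivation_predP. Qed.

Fact lie_subproof (X Y : vf) :
  (fun f : C => X (Y f) - Y (X f)) \in derivation_pred.
Proof.
apply/derivation_predP.
have [XL XM] := vfP X; have [YL YM] := vfP Y.
split=> [a f h|f h].
  rewrite YL XL XL YL mulrDr mulrN opprD -!addrA; congr (_ + _).
  by rewrite addrCA.
have XD f1 f2 : X (f1 + f2) = X f1 + X f2.
  have := XL 1 f1 f2; rewrite (_ : cinf_cst M 1 = 1) ?mul1r //.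
  exact: cinf_eqP.
have YD f1 f2 : Y (f1 + f2) = Y f1 + Y f2.
  have := YL 1 f1 f2; rewrite (_ : cinf_cst M 1 = 1) ?mul1r //.
  exact: cinf_eqP.
rewrite YM XM XD YD !XM !YM; ring.
Qed.
Definition lie (X Y : vf) : vf := Vf (lie_subproof X Y).

End VectorFields.


(* Covariant and (1,2)-tensor fields are encoded as the corresponding maps on
   vector fields that are linear over the ring of smooth functions. *)
Section Tensors.
Variables (R : realType) (m : nat) (M : smooth_manifold R m).
Local Notation C := (cinf M).
Local Notation V := (vf M).
Implicit Types (g omega : V -> V -> C) (theta delta : V -> C).
Implicit Types (J : V -> V) (nabla A : V -> V -> V) (X Y Z : V).

(* The tangent vector X_p is the derivation f |-> X f p; the existence of f with
   X f p != 0 says that it is nonzero. *)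
Definition riemannian_metric g :=
  [/\ forall X, scalar (g X),
      forall X Y, g X Y = g Y X &
      forall X p, (exists f : C, X f p != 0) -> 0 < g X X p].

Definition affine_connection nabla :=
  [/\ forall Y, linear (fun X => nabla X Y),
      forall X Y Z, nabla X (Y + Z) = nabla X Y + nabla X Z &
      forall X (f : C) Y, nabla X (f *: Y) = X f *: Y + f *: nabla X Y].

Definition levi_civita g nabla :=
  [/\ affine_connection nabla,
      forall X Y, nabla X Y - nabla Y X = lie X Y &
      forall X Y Z, X (g Y Z) = g (nabla X Y) Z + g Y (nabla X Z)].

(* Exterior derivative of a 2-form, in the normalization without factor 1/3. *)
Definition ext_d2 omega (X Y Z : V) : C :=
  X (omega Y Z) + Y (omega Z X) + Z (omega X Y)
  - omega (lie X Y) Z - omega (lie Y Z) X - omega (lie Z X) Y.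

Definition wedge12 theta omega (X Y Z : V) : C :=
  theta X * omega Y Z + theta Y * omega Z X + theta Z * omega X Y.

Definition cov_deriv2 nabla omega (X Y Z : V) : C :=
  X (omega Y Z) - omega (nabla X Y) Z - omega Y (nabla X Z).

(* delta = d^* omega for a 2-form omega, nabla being the Levi-Civita connection
   of g: (d^* omega)(X) = - sum_i (nabla_{e_i} omega)(e_i, X) at p, where the
   e_i form an orthonormal basis of the tangent space at p.  A global
   orthonormal frame need not exist, hence fields orthonormal at p only. *)
Definition is_codifferential2 g nabla omega delta :=
  scalar delta /\
  forall (p : M) (e : 'I_m -> V),
    (forall i j, g (e i) (e j) p = (i == j)%:R) ->
    forall X, delta X p = - \sum_(i < m) cov_deriv2 nabla omega (e i) (e i) X p.

Definition kahler_form g J (X Y : V) : C := g X (J Y).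

Definition chern_connection g J nabla nablaC :=
  affine_connection nablaC /\
  forall X Y Z, g (nablaC X Y) Z =
    g (nabla X Y) Z
    + cinf_cst M 2^-1 * ext_d2 (kahler_form g J) (J X) Y Z.

Definition bismut_connection g J nabla nablaB :=
  affine_connection nablaB /\
  forall X Y Z, g (nablaB X Y) Z =
    g (nabla X Y) Z
    - cinf_cst M 2^-1 * ext_d2 (kahler_form g J) (J X) (J Y) (J Z).

Definition tensor12 A :=
  (forall Y, linear (fun X => A X Y)) /\ (forall X, linear (A X)).

Definition weak_frobenius g A :=
  [/\ riemannian_metric g, tensor12 A &
      forall X Y Z, g (A X Y) Z = g X (A Y Z)].

End Tensors.

Section Hermitian.
Variables (R : realType) (n : nat) (M : smooth_manifold R (n + n)).
Local Notation C := (cinf M).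
Local Notation V := (vf M).
Implicit Types (g : V -> V -> C) (J : V -> V) (X Y : V).

(* Around every point there are complex coordinates z_k = x_k + i y_k with
   dz_k (J X) = i dz_k (X).  Vector fields act on global smooth functions, so
   the x_k and y_k are global functions that are coordinates only on the chart
   domain: every chart is of this form after shrinking, by bump functions. *)
Definition complex_structure J :=
  [/\ linear J,
      forall X, J (J X) = - X &
      forall p : M, exists (c : chart R (n + n) M) (x y : 'I_n -> C),
        [/\ is_smooth_chart c,
            chart_dom c p &
            forall q, chart_dom c q ->
              chart_map c q = row_mx (\row_k x k q) (\row_k y k q) /\
              forall (X : V) k,
                J X (x k) q = - X (y k) q /\ J X (y k) q = X (x k) q]].

Definition hermitian_structure g J :=
  [/\ riemannian_metric g,
      complex_structure J &
      forall X Y, g (J X) (J Y) = g X Y].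

Definition lee_form J (dstar_omega : V -> C) (X : V) : C :=
  cinf_cst M (n%:R - 1)^-1 * dstar_omega (J X).

End Hermitian.

(* Main.v *)
Require Import Defs.
From mathcomp Require Import all_boot all_order all_algebra.
From mathcomp Require Import all_classical all_reals topology normedtype derive.
From mathcomp Require Import ring.
Import GRing.Theory Num.Theory.
Local Open Scope ring_scope.

(* Lowering an index with g turns A^C and A^B into 3-tensors: substituting
   dOmega = theta /\ Omega and using J^2 = -1 and the J-invariance of g, the tensor of
   A^C is - 1/(2(n-1)) times the left-hand side of (i), and that of A^B is
   1/(2(n-1)) times the left-hand side of (ii).  In both cases the right-hand
   side is the left-hand side with (X, Y, Z) permuted to (Y, Z, X), so by the
   symmetry of g the identity is the weak Frobenius condition, up to a nonzero
   constant. *)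

Lemma cinf_cstM (R : realType) (m : nat) (M : smooth_manifold R m) (a b : R) :
  cinf_cst M (a * b) = cinf_cst M a * cinf_cst M b.
Proof. exact: cinf_eqP. Qed.

(** The ring of smooth functions may have zero divisors, but a nonzero constant is a unit, with
    inverse [cinf_cst M a^-1]. *)
Lemma cinf_cst_lreg (R : realType) (m : nat) (M : smooth_manifold R m) (a : R) :
  a != 0 -> GRing.lreg (cinf_cst M a).
Proof.
move=> a0 x y /(congr1 ( *%R (cinf_cst M a^-1))).
rewrite !mulrA -cinf_cstM mulVf // (_ : cinf_cst M 1 = 1) ?mul1r //.
exact: cinf_eqP.
Qed.

Lemma scalarN (R : pzRingType) (V : lmodType R) (f : V -> R) :
  scalar f -> forall v, f (- v) = - f v.
Proof.
move=> fL v; have f0 : f 0 = 0.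
  by have := fL (-1) 0 0; rewrite scaler0 addr0 mulN1r addNr.
by have := fL (-1) v 0; rewrite scaleN1r addr0 f0 addr0 mulN1r.
Qed.

Section Tensors.
Variables (R : realType) (m : nat) (M : smooth_manifold R m).
Implicit Types (g : vf M -> vf M -> cinf M) (A nabla : vf M -> vf M -> vf M).

(** The Leibniz terms [X f *: Y] of the two connections cancel. *)
Lemma affine_connection_sub_tensor nabla1 nabla2 :
  affine_connection nabla1 -> affine_connection nabla2 ->
  tensor12 (fun X Y => nabla1 X Y - nabla2 X Y).
Proof.
move=> [L1 D1 Z1] [L2 D2 Z2]; split=> [Y f X1 X2|X f Y1 Y2] /=.
  by rewrite L1 L2 scalerBr opprD addrACA.
rewrite D1 D2 Z1 Z2 opprD addrACA; congr (_ + _).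
by rewrite opprD addrACA subrr add0r scalerBr.
Qed.

Lemma metric_subl g (X Y Z : vf M) :
  riemannian_metric g -> g (X - Y) Z = g X Z - g Y Z.
Proof.
move=> [gL gS _].
by rewrite gS -scaleN1r addrC gL mulN1r addrC !(gS Z).
Qed.

(** Serves both equivalences, which differ only in [T] and [k]: symmetry gives
    [g X (A Y Z) = g (A Y Z) X = k * T Y Z X], and [k] cancels. *)
Lemma weak_frobenius_lower g A (T : vf M -> vf M -> vf M -> cinf M) (k : cinf M) :
  riemannian_metric g -> tensor12 A -> GRing.lreg k ->
  (forall X Y Z, g (A X Y) Z = k * T X Y Z) ->
  weak_frobenius g A <-> forall X Y Z, T X Y Z = T Y Z X.
Proof.
move=> gR At kreg gA; have [_ gS _] := gR.
split=> [[_ _ F] X Y Z|F].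
  by apply: kreg; rewrite -!gA F gS.
by split=> // X Y Z; rewrite [RHS]gS !gA F.
Qed.

End Tensors.

Theorem proposition3p9 (R : realType) (n : nat) (n_gt1 : (1 < n)%N)
    (M : smooth_manifold R (n + n))
    (g : vf M -> vf M -> cinf M) (J : vf M -> vf M)
    (hgJ : hermitian_structure g J)
    (nabla : vf M -> vf M -> vf M) (hnabla : levi_civita g nabla)
    (dsO : vf M -> cinf M)
    (hdsO : is_codifferential2 g nabla (kahler_form g J) dsO)
    (hdO : forall X Y Z : vf M,
       ext_d2 (kahler_form g J) X Y Z =
       wedge12 (lee_form J dsO) (kahler_form g J) X Y Z)
    (nablaC nablaB : vf M -> vf M -> vf M)
    (hC : chern_connection g J nabla nablaC)
    (hB : bismut_connection g J nabla nablaB) :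
  let Omega := kahler_form g J in
  let AC := fun X Y : vf M => nablaC X Y - nabla X Y in
  let AB := fun X Y : vf M => nablaB X Y - nabla X Y in
  (weak_frobenius g AC <->
   forall X Y Z : vf M,
     dsO X * Omega Y Z + dsO (J Y) * g Z X - dsO (J Z) * g X Y =
     dsO Y * Omega Z X + dsO (J Z) * g X Y - dsO (J X) * g Y Z) /\
  (weak_frobenius g AB <->
   forall X Y Z : vf M,
     dsO X * Omega Y Z + dsO Y * Omega Z X + dsO Z * Omega X Y =
     dsO Y * Omega Z X + dsO Z * Omega X Y + dsO X * Omega Y Z).
Proof.
move=> Omega AC AB.
have [gR [_ JJ _] gJ] := hgJ; have [gL gS _] := gR.
have [nablaA _ _] := hnabla; have [dL _] := hdsO.
have [CA CE] := hC; have [BA BE] := hB.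
have dN X : dsO (- X) = - dsO X by exact: scalarN dL X.
have gN X Y : g X (- Y) = - g X Y by exact: scalarN (gL X) Y.
set h := cinf_cst M 2^-1; set c := cinf_cst M (n%:R - 1)^-1.
have hc_reg : GRing.lreg (h * c).
  rewrite -cinf_cstM; apply: cinf_cst_lreg.
  (* [1 < n] enters here: it makes [n - 1], hence its inverse, nonzero. *)
  by rewrite mulf_neq0 // invr_eq0 ?pnatr_eq0 // subr_eq0 pnatr_eq1 gtn_eqF.
split.
- apply: (@weak_frobenius_lower _ _ _ _ _
    (fun X Y Z => dsO X * Omega Y Z + dsO (J Y) * g Z X - dsO (J Z) * g X Y)
    (- (h * c))) => //.
  + exact: affine_connection_sub_tensor.
  + by move=> x y; rewrite !mulNr => /oppr_inj /hc_reg.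
  (* The factor is negative since [J (J X) = - X] flips the sign of the Lee form at [J X] and of
     [Omega Z (J X)], while [Omega (J X) Y = g X Y]. *)
  move=> X Y Z; rewrite metric_subl // CE hdO -/h /wedge12 /lee_form -/c.
  by rewrite /Omega /kahler_form !JJ !dN !gN gJ; ring.
- apply: (@weak_frobenius_lower _ _ _ _ _
    (fun X Y Z => dsO X * Omega Y Z + dsO Y * Omega Z X + dsO Z * Omega X Y)
    (h * c)) => //.
  + exact: affine_connection_sub_tensor.
  (* [Omega] is [J]-invariant, and each Lee form value at a [J]-image contributes a minus sign,
     which cancels the one in the Bismut formula. *)
  move=> X Y Z; rewrite metric_subl // BE hdO -/h /wedge12 /lee_form -/c.
  by rewrite /Omega /kahler_form !gJ !JJ !dN; ring.
Qed.
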